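(* The differential $3$-form $\Omega=\frac12(\eta_2\wedge d\eta_2-\eta_3\wedge d\eta_3)$ on the $3$-Sasakian manifold $\mathbb{S}^7$ is $\mathrm{SU}(4)$-invariant, that is, $\tau_\sigma^*(\Omega)=\Omega$ for every $\sigma\in\mathrm{SU}(4)$.
   Context: $\mathrm{SU}(4)$ acts on the unit sphere $\mathbb{S}^7\subset\mathbb{C}^4$ by matrix multiplication, $\tau_\sigma(p)=\sigma p$. Identify $\mathbb{C}^4\cong\mathbb{H}^2$ by $(z_1,z_2,z_3,z_4)\mapsto(z_1+z_2\mathbf{j},z_3+z_4\mathbf{j})$, and let $\mathbf{i},\mathbf{j},\mathbf{k}$ act by left multiplication. Let $g$ be the canonical metric of $\mathbb{S}^7$ and $N$ the unit outward normal. Set $\xi_1(z)=-\mathbf{i}z$, $\xi_2(z)=-\mathbf{j}z$, $\xi_3(z)=-\mathbf{k}z$, and define $(1,1)$-tensors $\psi_s$ and $1$-forms $\eta_s$ ($s=1,2,3$) on $\mathbb{S}^7$ by the decompositions into tangent and normal parts $\mathbf{i}X=\psi_1(X)+\eta_1(X)N$, $\mathbf{j}X=\psi_2(X)+\eta_2(X)N$, $\mathbf{k}X=\psi_3(X)+\eta_3(X)N$; so $\eta_s(X)=g(X,\xi_s)$. *)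

(* Defs.v *)
From HB Require Import structures.
From mathcomp Require Import all_boot all_order all_algebra.
From mathcomp Require Import ring.
From mathcomp Require Import complex.
From mathcomp Require Import all_classical all_reals all_analysis.

Set Implicit Arguments.
Unset Strict Implicit.
Unset Printing Implicit Defensive.

Import Order.TTheory GRing.Theory Num.Theory.
Import numFieldNormedType.Exports.

Local Open Scope ring_scope.
Local Open Scope complex_scope.

Local Notation Re := (@complex.Re _).
Local Notation Im := (@complex.Im _).

Section Quaternions.
Variable R : realType.

Record quaternion := Quat { qr : R; qi : R; qj : R; qk : R }.

Definition addq (x y : quaternion) : quaternion :=
  let: Quat a b c d := x in let: Quat a' b' c' d' := y in
  Quat (a + a') (b + b') (c + c') (d + d').

Definition mulq (x y : quaternion) : quaternion :=
  let: Quat a b c d := x in let: Quat a' b' c' d' := y in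
  Quat (a * a' - b * b' - c * c' - d * d')
       (a * b' + b * a' + c * d' - d * c')
       (a * c' - b * d' + c * a' + d * b')
       (a * d' + b * c' - c * b' + d * a').

Definition quat_i : quaternion := Quat 0 1 0 0.
Definition quat_j : quaternion := Quat 0 0 1 0.
Definition quat_k : quaternion := Quat 0 0 0 1.

Definition quat_of_complex (z : R[i]) : quaternion := Quat (Re z) (Im z) 0 0.

End Quaternions.

Section ComplexFourSpace.
Variable R : realType.

Local Notation C4 := 'cV[R[i]]_4.
Local Notation H := (quaternion R).

Definition pair_to_H (z w : R[i]) : H :=
  addq (quat_of_complex z) (mulq (quat_of_complex w) (quat_j R)).

(* The indices 0, 1, 2, 3 of the column stand for z_1, z_2, z_3, z_4. *)
Definition C4_to_H2 (z : C4) : H * H :=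
  (pair_to_H (z (inord 0) 0) (z (inord 1) 0),
   pair_to_H (z (inord 2) 0) (z (inord 3) 0)).

(* Since i j = k, a + b i + c j + d k = (a + b i) + (c + d i) j. *)
Definition H2_to_C4 (q : H * H) : C4 :=
  \col_l nth 0 [:: qr q.1 +i* qi q.1; qj q.1 +i* qk q.1;
                   qr q.2 +i* qi q.2; qj q.2 +i* qk q.2] l.

Lemma C4_to_H2K : cancel C4_to_H2 H2_to_C4.
Proof.
move=> z; apply/matrixP => l m; rewrite mxE [m]ord1.
have E n (Hn : (n < 4)%N) : z (inord n) 0 = z (Ordinal Hn) 0.
  by rewrite (_ : inord n = Ordinal Hn) //; apply: val_inj; rewrite /= inordK.
case: l => -[|[|[|[|//]]]] Hl /=; rewrite -E;
  case: (z (inord 0) 0) (z (inord 1) 0) (z (inord 2) 0) (z (inord 3) 0)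
    => z0 z1 [z2 z3] [z4 z5] [z6 z7] /=; congr (_ +i* _); ring.
Qed.

Lemma H2_to_C4K : cancel H2_to_C4 C4_to_H2.
Proof.
move=> [[a b c d] [a' b' c' d']]; rewrite /C4_to_H2 /H2_to_C4 !mxE.
rewrite !inordK //= /pair_to_H /=.
by congr (_, _); congr Quat; ring.
Qed.

Definition lmulq (u : H) (z : C4) : C4 :=
  let: (q1, q2) := C4_to_H2 z in H2_to_C4 (mulq u q1, mulq u q2).

Definition rscale (a : R) (z : C4) : C4 := a%:C *: z.

(* The real part of the standard Hermitian product, i.e. the Euclidean inner
   product of R^8; its restriction to tangent vectors is the canonical metric
   of the sphere. *)
Definition dotr (z w : C4) : R := \sum_l Re (z l 0 * (w l 0)^*).

Definition enorm (z : C4) : R := Num.sqrt (dotr z z).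

Definition sphere7 (p : C4) : Prop := enorm p = 1.

Definition tangent (p X : C4) : Prop := dotr X p = 0.

Definition normal (p : C4) : C4 := p.

Definition xi (u : H) (p : C4) : C4 := - lmulq u p.

(* The tangent part psi and the normal component eta of u X, for u one of
   i, j, k and X tangent to the sphere at p. *)
Definition eta (u : H) (p X : C4) : R := dotr (lmulq u X) (normal p).

Definition psi (u : H) (p X : C4) : C4 :=
  lmulq u X - rscale (eta u p X) (normal p).

Lemma dotrE (z w : C4) :
  dotr z w = \sum_l (Re (z l 0) * Re (w l 0) + Im (z l 0) * Im (w l 0)).
Proof.
apply: eq_bigr => l _; case: (z l 0) => a b; case: (w l 0) => c d /=; ring.
Qed.

Lemma lmulq_decomp (u : H) (p X : C4) :
  lmulq u X = psi u p X + rscale (eta u p X) (normal p).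
Proof. by rewrite /psi subrK. Qed.

Lemma psi_tangent (u : H) (p X : C4) : sphere7 p -> tangent p (psi u p X).
Proof.
rewrite /sphere7 /enorm /tangent => p1.
have pp : dotr p p = 1.
  have pp0 : 0 <= dotr p p.
    by rewrite dotrE; apply: sumr_ge0 => l _; rewrite addr_ge0 // -expr2 sqr_ge0.
  by rewrite -(sqr_sqrtr pp0) p1 expr1n.
have dotBl (v : C4) a : dotr (v - rscale a p) p = dotr v p - a * dotr p p.
  rewrite !dotrE mulr_sumr -sumrB; apply: eq_bigr => l _.
  rewrite !mxE; case: (v l 0) => x y; case: (p l 0) => c d /=.
  ring.
by rewrite /psi dotBl pp mulr1 /eta subrr.
Qed.

Lemma eta_xi (u : H) (p X : C4) : qr u = 0 -> eta u p X = dotr X (xi u p).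
Proof.
case: u => u0 u1 u2 u3 /= ->; rewrite /eta /xi /normal !dotrE.
rewrite !big_ord_recl !big_ord0 !mxE /=.
have E n (z : C4) (l : 'I_4) : val l = n -> z (inord n) 0 = z l 0.
  by move=> <-; rewrite inord_val.
rewrite !(E 0 _ ord0) // !(E 1 _ (lift ord0 ord0)) //.
rewrite !(E 2 _ (lift ord0 (lift ord0 ord0))) //.
rewrite !(E 3 _ (lift ord0 (lift ord0 (lift ord0 ord0)))) //.
case: (X ord0 0) (X (lift ord0 ord0) 0) (X (lift ord0 (lift ord0 ord0)) 0)
  (X (lift ord0 (lift ord0 (lift ord0 ord0))) 0)
  => x0 x1 [x2 x3] [x4 x5] [x6 x7].
case: (p ord0 0) (p (lift ord0 ord0) 0) (p (lift ord0 (lift ord0 ord0)) 0)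
  (p (lift ord0 (lift ord0 (lift ord0 ord0))) 0)
  => p0 p1 [p2 p3] [p4 p5] [p6 p7] /=.
ring.
Qed.

End ComplexFourSpace.

(* A k-form assigns a value to a base point and k vectors.  For a form on the
   sphere only the values at points of the sphere and vectors tangent there are
   meaningful; equality of forms on the sphere is [eqform3]. *)
Section DifferentialForms.
Variable R : realType.

Local Notation C4 := 'cV[R[i]]_4.

Definition form1 := C4 -> C4 -> R.
Definition form2 := C4 -> C4 -> C4 -> R.
Definition form3 := C4 -> C4 -> C4 -> C4 -> R.

Definition eqform3 (w w' : form3) : Prop :=
  forall p, sphere7 p -> forall X Y Z, tangent p X -> tangent p Y ->
  tangent p Z -> w p X Y Z = w' p X Y Z.

Definition addform3 (w w' : form3) : form3 :=
  fun p X Y Z => w p X Y Z + w' p X Y Z.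

Definition scaleform3 (a : R) (w : form3) : form3 :=
  fun p X Y Z => a * w p X Y Z.

Definition wedge12 (a : form1) (b : form2) : form3 :=
  fun p X Y Z => a p X * b p Y Z + a p Y * b p Z X + a p Z * b p X Y.

Definition ddir (f : C4 -> R) (x v : C4) : R :=
  derive1 (fun t : R => f (x + rscale t v)) 0.

Definition pushforward (f : C4 -> C4) (x v : C4) : C4 :=
  \col_l (ddir (fun y => Re (f y l 0)) x v +i* ddir (fun y => Im (f y l 0)) x v).

Definition pullback1 (f : C4 -> C4) (a : form1) : form1 :=
  fun x X => a (f x) (pushforward f x X).

Definition pullback3 (f : C4 -> C4) (w : form3) : form3 :=
  fun x X Y Z =>
    w (f x) (pushforward f x X) (pushforward f x Y) (pushforward f x Z).

(* The exterior derivative on open subsets of C^4 = R^8: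
   da(X, Y) = X(a(Y)) - Y(a(X)) for constant vector fields X, Y. *)
Definition dext1 (a : form1) : form2 :=
  fun x X Y => ddir (fun y => a y Y) x X - ddir (fun y => a y X) x Y.

(* The retraction of C^4 \ {0} onto the sphere. *)
Definition retr (x : C4) : C4 := rscale (enorm x)^-1 x.

(* With r the retraction and i the inclusion of the sphere, r o i = id and d
   commutes with pullbacks, so da = d(i^* r^* a) = i^* d(r^* a) for a form a on
   the sphere; the right-hand side only uses the values of a on vectors tangent
   to the sphere, and d on an open subset of R^8. *)
Definition dsphere1 (a : form1) : form2 := dext1 (pullback1 retr a).

(* Likewise, the tangent map at p of a map f from the sphere to itself is the
   restriction to tangent vectors of the differential at p of f o r. *)
Definition pullback_sphere3 (f : C4 -> C4) (w : form3) : form3 :=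
  pullback3 (f \o retr) w.

End DifferentialForms.

Definition SU4 (R : realType) (sigma : 'M[R[i]]_4) : Prop :=
  sigma \is unitarymx /\ \det sigma = 1.

Definition tau (R : realType) (sigma : 'M[R[i]]_4) (p : 'cV[R[i]]_4) :
  'cV[R[i]]_4 := sigma *m p.

Definition eta2 (R : realType) : form1 R := eta (quat_j R).
Definition eta3 (R : realType) : form1 R := eta (quat_k R).

Definition Omega (R : realType) : form3 R :=
  scaleform3 2^-1
    (addform3 (wedge12 (@eta2 R) (dsphere1 (@eta2 R)))
       (scaleform3 (-1) (wedge12 (@eta3 R) (dsphere1 (@eta3 R))))).

(* Main.v *)
(* Put theta = eta_2 + i eta_3.  In complex coordinates theta_p(X) = w(X, p)
   for the complex symplectic form
   w(z, z') = z_1 z'_2 - z_2 z'_1 + z_3 z'_4 - z_4 z'_3, so that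
   d theta = -2 w on the sphere and Omega = 1/2 Re(theta /\ d theta) is, up to
   sign, the real part of the contraction of (w /\ w)/2 with p.  As (w /\ w)/2
   is the complex volume form of C^4, Omega_p(X, Y, Z) = Re det(p, X, Y, Z), and
   a matrix of determinant 1 preserves it. *)
Require Import Defs.
From mathcomp Require Import all_boot all_order all_algebra.
From mathcomp Require Import complex.
From mathcomp Require Import all_classical all_reals all_analysis.
From mathcomp Require Import ring lra.

Set Implicit Arguments.
Unset Strict Implicit.
Unset Printing Implicit Defensive.

Import Order.TTheory GRing.Theory Num.Theory.
Import numFieldNormedType.Exports.

Local Open Scope ring_scope.
Local Open Scope complex_scope.

Local Notation Re := (@complex.Re _).
Local Notation Im := (@complex.Im _).
Local Notation C4 R := 'cV[R[i]]_4.

(** * The contact forms in terms of the complex symplectic form *)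

Definition symp (R : realType) (z w : C4 R) : R[i] :=
  z (inord 0) 0 * w (inord 1) 0 - z (inord 1) 0 * w (inord 0) 0
  + z (inord 2) 0 * w (inord 3) 0 - z (inord 3) 0 * w (inord 2) 0.

Lemma sum_inord4 (V : nmodType) (F : 'I_4 -> V) :
  \sum_l F l = F (inord 0) + F (inord 1) + F (inord 2) + F (inord 3).
Proof.
rewrite !big_ord_recl big_ord0 addr0 !addrA.
by congr (F _ + F _ + F _ + F _); apply: val_inj; rewrite /= inordK.
Qed.

Lemma eta_j (R : realType) (p X : C4 R) : eta (quat_j R) p X = Re (symp X p).
Proof.
rewrite /eta dotrE sum_inord4 /symp /normal /lmulq /C4_to_H2 /H2_to_C4.
rewrite !mxE !inordK //=.
case: (X _ 0) (X _ 0) (X _ 0) (X _ 0) => a b [c d] [e f] [g h].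
case: (p _ 0) (p _ 0) (p _ 0) (p _ 0) => a' b' [c' d'] [e' f'] [g' h'] /=.
ring.
Qed.

Lemma eta_k (R : realType) (p X : C4 R) : eta (quat_k R) p X = Im (symp X p).
Proof.
rewrite /eta dotrE sum_inord4 /symp /normal /lmulq /C4_to_H2 /H2_to_C4.
rewrite !mxE !inordK //=.
case: (X _ 0) (X _ 0) (X _ 0) (X _ 0) => a b [c d] [e f] [g h].
case: (p _ 0) (p _ 0) (p _ 0) (p _ 0) => a' b' [c' d'] [e' f'] [g' h'] /=.
ring.
Qed.

Lemma symp_lin_l (R : realType) (a b : R) (u v w : C4 R) :
  symp (rscale a u + rscale b v) w = a%:C * symp u w + b%:C * symp v w.
Proof. rewrite /symp !mxE; ring. Qed.

Lemma symp_anti (R : realType) (u v : C4 R) : symp u v = - symp v u.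
Proof. rewrite /symp; ring. Qed.

(** * Derivatives of the norm and of the retraction along lines *)

Lemma dotr_ge0 (R : realType) (x : C4 R) : 0 <= dotr x x.
Proof.
by rewrite dotrE sumr_ge0 // => l _; rewrite -!expr2 addr_ge0 ?sqr_ge0.
Qed.

Lemma dotr_sphere (R : realType) (p : C4 R) : sphere7 p -> dotr p p = 1.
Proof.
by rewrite /sphere7 /enorm => p1; rewrite -(sqr_sqrtr (dotr_ge0 p)) p1 expr1n.
Qed.

Lemma dotrC (R : realType) (x y : C4 R) : dotr x y = dotr y x.
Proof. by rewrite !dotrE; apply: eq_bigr => l _; ring. Qed.

Lemma dotr_line (R : realType) (x X : C4 R) (t : R) :
  dotr (x + rscale t X) (x + rscale t X) =
  dotr x x + 2 * dotr x X * t + dotr X X * t ^+ 2.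
Proof.
rewrite !dotrE mulr_sumr !mulr_suml -!big_split; apply: eq_bigr => l _ /=.
rewrite !mxE; case: (x l 0) (X l 0) => a b [c d] /=; ring.
Qed.

(** Along the line the squared norm is the quadratic polynomial [q], so the chain rule applies;
    [q 0 > 0] keeps the square root and the inverse differentiable at 0. *)
Lemma is_derive_Venorm (R : realType) (x X : C4 R) : 0 < dotr x x ->
  is_derive (0 : R) 1 (fun t : R => (enorm (x + rscale t X))^-1)
    (- (dotr x X * (enorm x)^-1 ^+ 3)).
Proof.
move=> x0; have e0 : enorm x != 0 by rewrite gt_eqF // sqrtr_gt0.
pose q t : R := dotr x x + 2 * dotr x X * t + dotr X X * t ^+ 2.
have -> : (fun t => (enorm (x + rscale t X))^-1) =
    (fun t => (Num.sqrt (q t))^-1).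
  by apply: funext => t; rewrite /enorm dotr_line.
have q0 : q 0 = dotr x x by rewrite /q mulr0 expr0n mulr0 !addr0.
have dq : is_derive (0 : R) 1 q (2 * dotr x X).
  rewrite /q; apply: is_derive_eq.
  rewrite /GRing.scale /=; ring.
have ds : is_derive (q 0) 1 Num.sqrt (2 * Num.sqrt (q 0))^-1.
  by apply: is_derive1_sqrt; rewrite q0.
have dc : is_derive (0 : R) 1 (Num.sqrt \o q)
    ((2 * Num.sqrt (q 0))^-1 * (2 * dotr x X)).
  exact: is_derive1_comp.
have e1 : (Num.sqrt \o q) 0 = enorm x by rewrite /= q0.
have dv : (Num.sqrt \o q) 0 != 0 by rewrite e1.
apply: (is_derive_eq (is_deriveV dv dc)).
rewrite e1 q0 -/(enorm x) /GRing.scale /=; field; exact: e0.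
Qed.

(** All directional derivatives below are instances of this product rule: coordinates of the
    retraction have [n = 1], pullbacks of the contact forms have [n = 2]. *)
Lemma ddir_homog (R : realType) (f : C4 R -> R) (n : nat) (x X : C4 R) :
  0 < dotr x x -> (forall t, f (x + rscale t X) = f x + t * f X) ->
  ddir (fun y => (enorm y)^-1 ^+ n * f y) x X =
  (enorm x)^-1 ^+ n * f X - n%:R * dotr x X * (enorm x)^-1 ^+ n.+2 * f x.
Proof.
move=> x0 fL; rewrite /ddir derive1E.
have dv := is_derive_Venorm X x0.
have dn := is_deriveX n dv.
have df : is_derive (0 : R) 1 (fun t => f (x + rscale t X)) (f X).
  rewrite (_ : (fun t => _) = (fun t => f x + t * f X)); last exact: funext.
  by apply: is_derive_eq; rewrite /GRing.scale /= ; ring.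
have x0E : x + rscale 0 X = x by rewrite /rscale scale0r addr0.
have dp := is_deriveM dn df.
rewrite (_ : (fun t => _) = (fun t : R => (enorm (x + rscale t X))^-1) ^+ n
  * (fun t => f (x + rscale t X))); last by apply: funext => t; rewrite !fctE.
rewrite (derive_val (is_derive := dp)).
rewrite /GRing.scale /= !fctE x0E -mulr_natr.
(* The power rule produces the exponent [n.-1], which simplifies once zero is split off. *)
case: n {dn dp} => [|n]; first by rewrite expr0 /=; ring.
rewrite /= !exprS; ring.
Qed.

(** The map sends y to [sigma *m y] divided by the norm of y. The base point may lie off the sphere,
    because [dsphere1] differentiates the pulled back form along lines that leave the sphere. *)
Lemma pushforward_tau_retr (R : realType) (sigma : 'M[R[i]]_4) (x X : C4 R) :
  0 < dotr x x ->
  Defs.pushforward (tau sigma \o @retr R) x X =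
  rscale (enorm x)^-1 (sigma *m X)
  + rscale (- (dotr x X * (enorm x)^-1 ^+ 3)) (sigma *m x).
Proof.
move=> x0; apply/matrixP => l m; rewrite [m]ord1 mxE.
have fE (y : C4 R) :
    (tau sigma (retr y)) l 0 = ((enorm y)^-1)%:C * (sigma *m y) l 0.
  by rewrite /tau /retr /rscale -scalemxAr mxE.
rewrite (_ : (fun y => Re _) =
    fun y => (enorm y)^-1 ^+ 1 * Re ((sigma *m y) l 0)); last first.
  by apply: funext => y; rewrite /= fE; case: (_ l 0) => a b /=; ring.
rewrite (_ : (fun y => Im _) =
    fun y => (enorm y)^-1 ^+ 1 * Im ((sigma *m y) l 0)); last first.
  by apply: funext => y; rewrite /= fE; case: (_ l 0) => a b /=; ring.
have lin t : (sigma *m (x + rscale t X)) l 0 =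
    (sigma *m x) l 0 + t%:C * (sigma *m X) l 0.
  by rewrite mulmxDr /rscale -scalemxAr !mxE.
rewrite (ddir_homog (f := fun y => Re ((sigma *m y) l 0))) //; last first.
  by move=> t; rewrite lin; case: (_ l 0) (_ l 0) => a b [c d] /=; ring.
rewrite (ddir_homog (f := fun y => Im ((sigma *m y) l 0))) //; last first.
  by move=> t; rewrite lin; case: (_ l 0) (_ l 0) => a b [c d] /=; ring.
have rE a b (u v : C4 R) :
    (rscale a u + rscale b v) l 0 = a%:C * u l 0 + b%:C * v l 0.
  by rewrite !mxE.
rewrite rE.
case: ((sigma *m x) l 0) ((sigma *m X) l 0) => a b [c d] /=.
congr (_ +i* _); ring.
Qed.

(** * The exterior derivative of a contact form on the sphere *)

Lemma dotr_tangent_line_gt0 (R : realType) (p X : C4 R) (t : R) :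
  sphere7 p -> tangent p X -> 0 < dotr (p + rscale t X) (p + rscale t X).
Proof.
move=> p1 pX; rewrite dotr_line (dotr_sphere p1) dotrC pX mulr0 mul0r addr0.
by rewrite ltr_pwDl // mulr_ge0 ?sqr_ge0 // dotr_ge0.
Qed.

(* [w] stands for the real or the imaginary part of [symp]. *)
Lemma dsphere1_bilinear (R : realType) (w : C4 R -> C4 R -> R) (a : form1 R)
    (p X Y : C4 R) :
  (forall b c u v z, w (rscale b u + rscale c v) z = b * w u z + c * w v z) ->
  (forall u v, w u v = - w v u) ->
  (forall q Z, a q Z = w Z q) ->
  sphere7 p -> tangent p X -> tangent p Y ->
  dsphere1 a p X Y = - 2 * w X Y.
Proof.
move=> wl wa aE p1 pX pY.
have rE (c : R) (u : C4 R) : rscale c u = rscale c u + rscale 0 u.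
  by rewrite /rscale scale0r addr0.
have e1 (u : C4 R) : u = rscale 1 u by rewrite /rscale scale1r.
have wZ c u z : w (rscale c u) z = c * w u z by rewrite rE wl mul0r addr0.
have wxx u : w u u = 0 by have := wa u u; lra.
(* Inserting the identity matrix lets [pushforward_tau_retr] compute the differential of [retr]
   itself. *)
have rt : (@retr R) = tau 1%:M \o @retr R.
  by apply: funext => y; rewrite /= /tau mul1mx.
(* The radial part of the pushforward is a multiple of y and is killed by [w y y = 0]. *)
have pb (y Z : C4 R) : 0 < dotr y y ->
    pullback1 (@retr R) a y Z = (enorm y)^-1 ^+ 2 * w Z y.
  move=> y0; rewrite /pullback1 {2}rt pushforward_tau_retr // !mul1mx.
  rewrite aE wl /retr (wa _ (rscale _ _)) wZ (wa y (rscale _ _)) wZ wxx.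
  rewrite (wa Z y).
  ring.
have dd (Z V : C4 R) : tangent p V ->
    ddir (fun y => pullback1 (@retr R) a y Z) p V = w Z V.
  move=> pV.
  have -> : ddir (fun y => pullback1 (@retr R) a y Z) p V =
      ddir (fun y => (enorm y)^-1 ^+ 2 * w Z y) p V.
    (* The squared norm on a tangent line is 1 plus a nonnegative term, so [pb] holds for every t
       and not only near 0. *)
    rewrite /ddir; congr derive1; apply: funext => t.
    by rewrite pb ?dotr_tangent_line_gt0.
  rewrite ddir_homog; first last.
  - move=> t; rewrite (wa Z (_ + _)) [in LHS](e1 p) wl (wa Z p) (wa Z V).
    ring.
  - by rewrite dotr_sphere.
  by rewrite dotrC pV p1 !invr1 !expr1n; ring.
(* Both terms of the exterior derivative contribute equally by antisymmetry, whence the factor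
   -2. *)
transitivity (w Y X - w X Y); last by rewrite (wa Y X); ring.
by congr (_ - _); apply: dd.
Qed.

(** * The complex volume form and its invariance *)

Definition mx_of_cols (R : realType) (p X Y Z : C4 R) : 'M[R[i]]_4 :=
  \matrix_(i, j) nth 0 [:: p; X; Y; Z] j i 0.

Lemma mulmx_cols (R : realType) (sigma : 'M[R[i]]_4) (p X Y Z : C4 R) :
  sigma *m mx_of_cols p X Y Z =
  mx_of_cols (sigma *m p) (sigma *m X) (sigma *m Y) (sigma *m Z).
Proof.
apply/matrixP => i [[|[|[|[|//]]]] Hj]; rewrite !mxE /=;
  by apply: eq_bigr => l _; rewrite !mxE.
Qed.

(* Laplace expansion along the first row, over plain indices so that it
   computes. *)
Fixpoint laplace_det (K : comPzRingType) (n : nat) (f : nat -> nat -> K) : K :=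
  if n is m.+1 then
    \sum_(j < m.+1) (-1) ^+ j * f 0%N j
      * laplace_det m (fun i k => f i.+1 (bump j k))
  else 1.

Lemma det_laplaceE (K : comPzRingType) (n : nat) (f : nat -> nat -> K) :
  \det (\matrix_(i < n, j < n) f i j) = laplace_det n f.
Proof.
elim: n f => [|n IHn] f; first by rewrite det_mx00.
rewrite (expand_det_row _ ord0) /=; apply: eq_bigr => j _; rewrite -IHn.
rewrite mxE /cofactor add0n mulrA (mulrC (f _ _)); congr (_ * \det _).
by apply/matrixP => i k; rewrite !mxE.
Qed.

(** This is the volume form (w /\ w)/2 evaluated at p, X, Y, Z; the sign comes from moving p to the
    second argument of [symp]. *)
Lemma det_mx_of_cols (R : realType) (p X Y Z : C4 R) :
  \det (mx_of_cols p X Y Z) =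
  - (symp X p * symp Y Z + symp Y p * symp Z X + symp Z p * symp X Y).
Proof.
pose f i j := nth 0 [:: p; X; Y; Z] j (inord i) 0.
rewrite (_ : mx_of_cols p X Y Z = \matrix_(i < 4, j < 4) f i j); last first.
  by apply/matrixP => i j; rewrite !mxE /f inord_val.
rewrite det_laplaceE /= !(big_ord_recl, big_ord0) /= /bump /= /f /= /symp.
ring.
Qed.

Lemma dotr_unitary (R : realType) (sigma : 'M[R[i]]_4) (x y : C4 R) :
  sigma \is unitarymx -> dotr (sigma *m x) (sigma *m y) = dotr x y.
Proof.
move=> su.
have dE (z w : C4 R) : dotr z w = Re ((z^T *m map_mx Num.conj w) 0 0).
  by rewrite /dotr mxE raddf_sum; apply: eq_bigr => l _; rewrite !mxE.
rewrite !dE trmx_mul map_mxM -mulmxA (mulmxA sigma^T).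
(* This is orthonormality of the columns, that is, unitarity of the transpose. *)
have -> : sigma^T *m map_mx Num.conj sigma = 1%:M.
  have /unitarymxP : sigma^T \is unitarymx by rewrite trmx_unitary.
  by rewrite trmxK.
by rewrite mul1mx.
Qed.

(** The difference of the two wedge products is the real part of theta /\ d theta, as Re(ab) = Re a
    Re b - Im a Im b; the factors 1/2 and -2 leave exactly the sign in [det_mx_of_cols]. *)
Lemma Omega_det (R : realType) (p X Y Z : C4 R) :
  sphere7 p -> tangent p X -> tangent p Y -> tangent p Z ->
  Omega p X Y Z = Re (\det (mx_of_cols p X Y Z)).
Proof.
move=> p1 pX pY pZ.
have dj (U V : C4 R) : tangent p U -> tangent p V ->
    dsphere1 (@eta2 R) p U V = - 2 * Re (symp U V).
  apply: (dsphere1_bilinear (w := fun u v => Re (symp u v))) => //.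
  - move=> b c u v z; rewrite symp_lin_l.
    by case: (symp u z) (symp v z) => ? ? [? ?] /=; ring.
  - by move=> u v; rewrite symp_anti; case: (symp v u).
  - exact: eta_j.
have dk (U V : C4 R) : tangent p U -> tangent p V ->
    dsphere1 (@eta3 R) p U V = - 2 * Im (symp U V).
  apply: (dsphere1_bilinear (w := fun u v => Im (symp u v))) => //.
  - move=> b c u v z; rewrite symp_lin_l.
    by case: (symp u z) (symp v z) => ? ? [? ?] /=; ring.
  - by move=> u v; rewrite symp_anti; case: (symp v u).
  - exact: eta_k.
rewrite /Omega /scaleform3 /addform3 /wedge12 !dj // !dk //.
rewrite /eta2 /eta3 !eta_j !eta_k det_mx_of_cols.
case: (symp X p) (symp Y p) (symp Z p) => a b [c d] [e f].
case: (symp Y Z) (symp Z X) (symp X Y) => a' b' [c' d'] [e' f'] /=.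
by field.
Qed.

Theorem proposition5p9 (R : realType) (sigma : 'M[R[i]]_4) :
  SU4 sigma -> eqform3 (pullback_sphere3 (tau sigma) (@Omega R)) (@Omega R).
Proof.
move=> [su sdet] p p1 X Y Z pX pY pZ.
have pp : 0 < dotr p p by rewrite dotr_sphere.
(* On the sphere and for tangent V the radial correction vanishes, so the differential is [sigma]
   itself. *)
have pf (V : C4 R) : tangent p V ->
    Defs.pushforward (tau sigma \o @retr R) p V = sigma *m V.
  move=> pV; rewrite pushforward_tau_retr // dotrC pV p1 mul0r oppr0 invr1.
  by rewrite /rscale scale0r addr0 scale1r.
(* Unitarity makes [Omega_det] applicable at the image point too; determinant 1 then gives equality
   of the two determinants. *)
have tV (V : C4 R) : tangent p V -> tangent (sigma *m p) (sigma *m V).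
  by rewrite /tangent dotr_unitary.
have rp : (tau sigma \o @retr R) p = sigma *m p.
  by rewrite /= /retr p1 invr1 /rscale scale1r.
transitivity (Omega (sigma *m p) (sigma *m X) (sigma *m Y) (sigma *m Z)).
  by congr Omega; [exact: rp | exact: pf | exact: pf | exact: pf].
have sp : sphere7 (sigma *m p) by rewrite /sphere7 /enorm dotr_unitary.
rewrite (Omega_det p1 pX pY pZ) (Omega_det sp (tV _ pX) (tV _ pY) (tV _ pZ)).
by rewrite -mulmx_cols det_mulmx sdet mul1r.
Qed.
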